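(* Let $p$ and $r$ be distinct primes with $p\equiv1\pmod3$ and $\gcd(3,r)=1$. Let $t\ge1$, $m=3t$, $q=p^m$, $c=\frac{q-1}{3}$ and $k=\frac3r\Psi_r(q)$, and assume $q\equiv1\pmod r$. Let $a,b$ be integers with $4p^t=a^2+27b^2$, $a\equiv1\pmod3$ and $\gcd(a,p)=1$. For non-negative integers $\ell_1,\ell_2,\ell_3$ with $h=\ell_1+\ell_2+\ell_3\le r$ put $$w_{\ell_1,\ell_2,\ell_3}=\tfrac{p-1}{3p}\Big(hq+\big(a(\tfrac{\ell_2+\ell_3}{2}-\ell_1)+\tfrac{9b}{2}(\ell_2-\ell_3)\big)p^t\Big),\qquad A_{\ell_1,\ell_2,\ell_3}=\binom{r}{h}\binom{h}{\ell_1,\ell_2,\ell_3}c^h.$$ Then the weights of $\mathcal{C}(k,q^r)$ are the numbers $w_{\ell_1,\ell_2,\ell_3}$, with frequencies $A_{\ell_1,\ell_2,\ell_3}$ (frequencies of tuples giving the same weight being added).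
   Context: $\Psi_r(x)=x^{r-1}+\cdots+x+1$. Let $Q=p^M$, $\omega$ a primitive element of $\mathbb{F}_Q$, $k\mid Q-1$, $n=\frac{Q-1}{k}$. The irreducible cyclic code $\mathcal{C}(k,Q)\subseteq\mathbb{F}_p^n$ consists of the words $c_\gamma=(\mathrm{Tr}_{Q/p}(\gamma\,\omega^{ki}))_{i=0}^{n-1}$, $\gamma\in\mathbb{F}_Q$; the weight of a word is its number of nonzero coordinates, and the frequency of $w$ is $\#\{\gamma\in\mathbb{F}_Q: w(c_\gamma)=w\}$. *)

(* Defs.v *)
From HB Require Import structures.
From mathcomp Require Import all_boot all_order all_algebra all_field.
Set Implicit Arguments. Unset Strict Implicit. Unset Printing Implicit Defensive.
Import Order.TTheory GRing.Theory Num.Theory.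

Definition Psi (r x : nat) : nat := (\sum_(i < r) x ^ i)%N.

Local Open Scope ring_scope.

(* absolute trace Tr_{Q/p}(x) = sum_{i<M} x^(p^i), for F of order p^M *)
Definition trace_abs (F : finFieldType) (p M : nat) (x : F) : F :=
  \sum_(i < M) x ^+ (p ^ i).

Definition cw_weight (F : finFieldType) (p M k : nat) (omega gamma : F) : nat :=
  #|[set i : 'I_((#|F|.-1) %/ k) |
      trace_abs p M (gamma * omega ^+ (k * i)) != 0]|.

Definition cw_freq (F : finFieldType) (p M k : nat) (omega : F) (w : nat) : nat :=
  #|[set gamma : F | cw_weight p M k omega gamma == w]|.

Definition multinom3 (l1 l2 l3 : nat) : nat :=
  ((l1 + l2 + l3)`! %/ (l1`! * l2`! * l3`!))%N.

(* Main.v *)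
Require Import Defs.
From HB Require Import structures.
From mathcomp Require Import all_boot all_order all_algebra all_field.
From mathcomp Require Import zify ring.
Set Implicit Arguments. Unset Strict Implicit. Unset Printing Implicit Defensive.
Import Order.TTheory GRing.Theory Num.Theory.
Local Open Scope ring_scope.

(** Let [K] be the subfield of order [q = p ^ (3 t)] of [F], [c = (q - 1) / 3] and
    [beta = omega ^ k].  The powers [beta ^ j], [j < r], form a Kummer basis of [F]
    over [K], and the code coordinates run over [beta ^ j * u] for [j < r] and [u] a
    nonzero cube of [K].  Hence [gamma |-> (Tr_{F/K} (gamma beta ^ j))_j] is a
    bijection of [F] onto [K ^ r] that turns the weight into a sum of [r] values of
    the function [N (y) = #{u a nonzero cube of K | Tr_{K/p} (y u) <> 0}], and the
    weight enumerator of the code is the [r]-th power of that of [N].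

    For [y <> 0], [N (y)] depends only on the cubic class of [y], through the cubic
    exponential sum [G (y) = \sum_x psi (y x ^ 3)]:
    [3 p N (y) = (p - 1) (q - G (y))].  The three values of [G] are integers
    congruent to 1 modulo 3, and their [n]-th power sum counts the zeros in [K ^ n] of
    the diagonal cubic form [\sum_j x_j ^ 3].  For [n = 3] that number is congruent to
    [(3 c)! / c! ^ 3] modulo [p], hence prime to [p].  It follows that the three values
    are [p ^ t u_i] with [u_i] prime to [p], [\sum_i u_i = 0] and
    [\sum_i u_i ^ 2 = 6 p ^ t], and the uniqueness of the representation
    [4 p ^ t = a ^ 2 + 27 b ^ 2] gives [{u_i} = {a, - (a + 9 b) / 2, - (a - 9 b) / 2}]. *)

(** * Traces and additive characters *)

Lemma expr_sum_pchar (R : comNzRingType) (q : nat) (I : Type) (s : seq I)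
    (P : pred I) (f : I -> R) :
  [pchar R].-nat q ->
  (\sum_(i <- s | P i) f i) ^+ q = \sum_(i <- s | P i) f i ^+ q.
Proof.
move=> pchar_q; apply: (big_morph (fun x => x ^+ q)) => [x y|].
  exact: exprDn_pchar.
by rewrite expr0n gtn_eqF //; case/andP: pchar_q.
Qed.

Lemma expr_fixed_iter (R : pzSemiRingType) (x : R) q j : x ^+ q = x -> x ^+ (q ^ j) = x.
Proof. by move=> xq; elim: j => // j IHj; rewrite expnSr exprM IHj. Qed.

Lemma big_ord_mul (R : Type) (idx : R) (op : Monoid.law idx) m n (f : nat -> R) :
  \big[op/idx]_(i < m * n) f i =
    \big[op/idx]_(s < n) \big[op/idx]_(j < m) f (m * s + j)%N.
Proof.
elim: n => [|n IHn]; first by rewrite muln0 !big_ord0.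
by rewrite mulnSr big_split_ord big_ord_recr /= IHn.
Qed.

Section TraceAbs.

Variables (K : finFieldType) (q : nat).
Hypothesis pchar_q : [pchar K].-nat q.

Lemma trace_absD m (x y : K) :
  trace_abs q m (x + y) = trace_abs q m x + trace_abs q m y.
Proof.
rewrite -big_split; apply: eq_bigr => i _; apply: exprDn_pchar.
by rewrite pnatX pchar_q.
Qed.

Lemma trace_abs0 m : trace_abs q m (0 : K) = 0.
Proof. by apply: (addIr (trace_abs q m 0)); rewrite -trace_absD !add0r. Qed.

Lemma trace_abs_fixed m (x : K) :
  x ^+ (q ^ m) = x -> trace_abs q m x ^+ q = trace_abs q m x.
Proof.
move=> xqm; rewrite expr_sum_pchar //; apply: (addrI x).
transitivity (\sum_(i < m.+1) x ^+ (q ^ i)).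
  rewrite big_ord_recl; congr (_ + _).
  by apply: eq_bigr => i _; rewrite -exprM -expnSr.
by rewrite big_ord_recr /= xqm addrC.
Qed.

Lemma trace_absMr m (z x : K) :
  x ^+ q = x -> trace_abs q m (z * x) = trace_abs q m z * x.
Proof.
move=> xq; rewrite mulr_suml; apply: eq_bigr => j _.
by rewrite exprMn (expr_fixed_iter j xq).
Qed.

Lemma trace_abs_tower m r (z : K) :
  trace_abs q (m * r) z = trace_abs q m (trace_abs (q ^ m) r z).
Proof.
rewrite /trace_abs (big_ord_mul _ m r (fun i => z ^+ (q ^ i))) exchange_big /=.
apply: eq_bigr => i _; rewrite expr_sum_pchar ?pnatX ?pchar_q //.
by apply: eq_bigr => j _; rewrite -exprM -expnM -expnD.
Qed.

End TraceAbs.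

Lemma exists_trace_abs_neq0 (K : finFieldType) (q m : nat) :
  (1 < q)%N -> #|K| = (q ^ m)%N -> exists x : K, trace_abs q m x != 0.
Proof.
move=> q_gt1 cardK; case: m cardK => [|m] cardK.
  by have := finNzRing_gt1 K; rewrite cardK.
apply/existsP; apply: contraT => /existsPn trace0.
pose traceP : {poly K} := \sum_(i < m.+1) 'X^(q ^ i).
have size_traceP : size traceP = (q ^ m).+1.
  rewrite /traceP big_ord_recr /= addrC size_polyDl ?size_polyXn //.
  apply: leq_ltn_trans (size_sum _ _ _) _; rewrite ltnS.
  by apply/bigmax_leqP => i _; rewrite size_polyXn ltn_exp2l.
have traceP_neq0 : traceP != 0 by rewrite -size_poly_gt0 size_traceP.
have roots_traceP : all (root traceP) (enum K).
  apply/allP => x _; rewrite rootE horner_sum.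
  by have := trace0 x; rewrite negbK; under eq_bigr do rewrite hornerXn.
have := max_poly_roots traceP_neq0 roots_traceP (enum_uniq K).
by rewrite size_traceP -cardE cardK ltnS leqNgt ltn_exp2l // ltnSn.
Qed.

Lemma prime_subfieldP (R : fieldType) p (x : R) :
  p \in [pchar R] -> x ^+ p = x -> exists n : 'F_p, x = n%:R.
Proof.
move=> pcharRp xp; have p_pr := pcharf_prime pcharRp.
pose A := pPrimeCharType pcharRp.
have prodE : \prod_(a : 'F_p) ('X - (a%:A : A)%:P) = 'X^p - 'X.
  transitivity (map_poly (in_alg A) (\prod_(a : 'F_p) ('X - a%:P))).
    by rewrite rmorph_prod; apply: eq_bigr => a _; rewrite rmorphB /= map_polyX map_polyC.
  by rewrite -finField_genPoly card_Fp // rmorphB /= map_polyX map_polyXn.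
have : root (\prod_(a : 'F_p) ('X - (a%:A : A)%:P)) x.
  by rewrite prodE rootE !hornerE xp subrr.
rewrite rootE horner_prod => /prodf_eq0[a _]; rewrite hornerXsubC subr_eq0 => /eqP->.
by exists a; apply: mulr1.
Qed.

Lemma sum_expr_unity_root (R : idomainType) n (z : R) : z ^+ n = 1 ->
  \sum_(i < n) z ^+ i = n%:R * (z == 1)%:R.
Proof.
move=> zn1; have [->|] := eqVneq z 1.
  by under eq_bigr do rewrite expr1n; rewrite sumr_const card_ord mulr1.
rewrite -subr_eq0 mulr0 => z_neq1; apply: (mulfI z_neq1).
by rewrite -subrX1 zn1 subrr mulr0.
Qed.

Lemma eqr_nat_pchar (R : nzRingType) p i j : p \in [pchar R] ->
  (i%:R == j%:R :> R) = (i == j %[mod p])%N.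
Proof.
move=> pcharRp; wlog le_ji : i j / (j <= i)%N => [symm|].
  by have [/symm//|/ltnW/symm] := leqP j i; rewrite eq_sym => ->; rewrite eq_sym.
by rewrite -subr_eq0 -natrB // eqn_mod_dvd // (dvdn_pcharf pcharRp).
Qed.

Section AdditiveCharacter.

Variables (K : finFieldType) (p m : nat) (xi : algC).
Hypotheses (p_pr : prime p) (cardK : #|K| = (p ^ m)%N).
Hypothesis xi_prim : p.-primitive_root xi.

Let pcharKp : p \in [pchar K] := card_finPcharP cardK p_pr.

Let pchar_p : [pchar K].-nat p.
Proof. by rewrite pnatE. Qed.

Definition prime_digit (x : K) : nat :=
  if [pick n : 'F_p | x == n%:R] is Some n then val n else 0.

Definition add_char (x : K) : algC := xi ^+ prime_digit (trace_abs p m x).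

Lemma trace_digitK (x : K) : (prime_digit (trace_abs p m x))%:R = trace_abs p m x.
Proof.
rewrite /prime_digit; case: pickP => [n /eqP //|no_digit].
have [|n digit_n] := prime_subfieldP pcharKp (x := trace_abs p m x).
  by apply: trace_abs_fixed; rewrite // -cardK expf_card.
by have := no_digit n; rewrite digit_n eqxx.
Qed.

Lemma add_charE (x : K) n : trace_abs p m x = n%:R -> add_char x = xi ^+ n.
Proof.
rewrite -trace_digitK => /eqP; rewrite (eqr_nat_pchar _ _ pcharKp) => digitE.
by apply/eqP; rewrite (eq_prim_root_expr xi_prim).
Qed.

Lemma add_char0 : add_char 0 = 1.
Proof. by rewrite (@add_charE 0 0) ?trace_abs0 ?expr0. Qed.

Lemma add_charD (x y : K) : add_char (x + y) = add_char x * add_char y.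
Proof.
rewrite -exprD; apply: add_charE.
by rewrite natrD !trace_digitK trace_absD.
Qed.

Lemma add_char_sum (I : Type) (s : seq I) (P : pred I) (f : I -> K) :
  add_char (\sum_(i <- s | P i) f i) = \prod_(i <- s | P i) add_char (f i).
Proof. exact: (big_morph add_char add_charD add_char0). Qed.

Lemma add_charMn (x : K) n : add_char (x *+ n) = add_char x ^+ n.
Proof. by rewrite -[n]card_ord -sumr_const add_char_sum prodr_const. Qed.

Lemma add_char_eq1 (x : K) : (add_char x == 1) = (trace_abs p m x == 0).
Proof. by rewrite -(prim_order_dvd xi_prim) (dvdn_pcharf pcharKp) trace_digitK. Qed.

Lemma Aint_add_char (x : K) : add_char x \in Aint.
Proof. by rewrite rpredX // (Aint_prim_root xi_prim). Qed.

Lemma sum_add_char (z : K) :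
  \sum_y add_char (y * z) = #|K|%:R * (z == 0)%:R.
Proof.
have [->|z_neq0] := eqVneq z 0.
  under eq_bigr do rewrite mulr0 add_char0.
  by rewrite sumr_const mulr1.
have [x trace_x] := exists_trace_abs_neq0 (prime_gt1 p_pr) cardK.
apply/eqP; rewrite mulr0 -(mulIr_eq0 _ (mulIf (_ : add_char x - 1 != 0))).
  rewrite mulrBr mulr1 subr_eq0 [X in _ == X](reindex_inj (addIr (x / z))) mulr_suml.
  by apply/eqP/eq_bigr => y _; rewrite mulrDl divfK // add_charD.
by rewrite subr_eq0 add_char_eq1.
Qed.

Lemma sum_add_charMn (z : K) :
  \sum_(s < p.-1) add_char (z *+ s.+1) = p%:R * (trace_abs p m z == 0)%:R - 1.
Proof.
have p_gt0 := prime_gt0 p_pr.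
suff <- : \sum_(s < p) add_char (z *+ s) = p%:R * (trace_abs p m z == 0)%:R.
  rewrite -(big_mkord xpredT (fun s => add_char (z *+ s))) big_ltn // big_add1.
  by rewrite big_mkord mulr0n add_char0 addrC addKr.
under eq_bigr do rewrite add_charMn.
rewrite sum_expr_unity_root ?add_char_eq1 //.
by rewrite exprAC (prim_expr_order xi_prim) expr1n.
Qed.

End AdditiveCharacter.

(** * Power residue classes *)

Lemma card_natr0 (K : finFieldType) : (#|K|)%:R = 0 :> K.
Proof.
have : \sum_(x : K) x = \sum_(x : K) (x + 1) by apply: reindex_inj (addIr 1).
by rewrite big_split /= sumr_const -[LHS]addr0 => /addrI.
Qed.

Lemma prim_root_neq0 (R : nzRingType) n (g : R) : n.-primitive_root g -> g != 0.
Proof.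
move=> g_prim; apply: contra_eq_neq (prim_expr_order g_prim) => ->.
by rewrite expr0n gtn_eqF ?(prim_order_gt0 g_prim) // eq_sym oner_neq0.
Qed.

Lemma prim_root_expr_inj (R : idomainType) n (g : R) : n.-primitive_root g ->
  injective (fun i : 'I_n => g ^+ i).
Proof.
move=> g_prim i j /eqP; rewrite (eq_prim_root_expr g_prim) !modn_small // => /eqP.
exact: val_inj.
Qed.

Lemma nonzero_prim_root (K : finFieldType) n (g : K) : n.-primitive_root g ->
  (forall x : K, x != 0 -> x ^+ n = 1) -> [set~ 0] = [set g ^+ i | i : 'I_n].
Proof.
move=> g_prim expr_n; apply/setP => x; rewrite !inE; apply/idP/imsetP.
  by move/expr_n/(prim_rootP g_prim) => [i ->]; exists i.
by case=> i _ ->; rewrite expf_neq0 // (prim_root_neq0 g_prim).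
Qed.

Section PowerClasses.

Variables (K : finFieldType) (d c : nat) (g : K).
Hypotheses (cardK : #|K| = (d * c).+1) (g_prim : (d * c).-primitive_root g).

Let order_gt0 : (0 < d * c)%N := prim_order_gt0 g_prim.

Let d_gt0 : (0 < d)%N.
Proof. by move: order_gt0; rewrite muln_gt0 => /andP[]. Qed.

Let c_gt0 : (0 < c)%N.
Proof. by move: order_gt0; rewrite muln_gt0 => /andP[]. Qed.

Lemma expf_order (x : K) : x != 0 -> x ^+ (d * c) = 1.
Proof.
by move=> x_neq0; apply: (mulfI x_neq0); rewrite -exprS -cardK expf_card mulr1.
Qed.

Lemma sum_prim_root (V : nmodType) (f : K -> V) :
  \sum_x f x = f 0 + \sum_(i < d * c) f (g ^+ i).
Proof.
rewrite (bigD1 0) //=; congr (_ + _).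
transitivity (\sum_(x in [set g ^+ i | i : 'I_(d * c)]) f x).
  by rewrite -(nonzero_prim_root g_prim expf_order); apply: eq_bigl => x; rewrite !inE.
by rewrite big_imset //= => i j _ _; apply: prim_root_expr_inj g_prim i j.
Qed.

Lemma sum_powers (V : nmodType) (f : K -> V) :
  \sum_x f (x ^+ d) = f 0 + (\sum_(s < c) f (g ^+ (d * s))) *+ d.
Proof.
rewrite sum_prim_root expr0n gtn_eqF // mulnC; congr (_ + _).
rewrite (big_ord_mul _ c d (fun i => f ((g ^+ i) ^+ d))).
rewrite -[in X in _ *+ X](card_ord d) -sumr_const.
apply: eq_bigr => j _; apply: eq_bigr => s _; congr f.
rewrite -exprM mulnDl exprD mulnAC -(mulnC d c) exprM (prim_expr_order g_prim).
by rewrite expr1n mul1r mulnC.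
Qed.

Lemma sum_power_classes (V : nmodType) (f : K -> V) :
  (forall y u, u != 0 -> f (y * u ^+ d) = f y) ->
  \sum_y f y = f 0 + (\sum_(i < d) f (g ^+ i)) *+ c.
Proof.
move=> f_class; rewrite sum_prim_root (big_ord_mul _ d c (fun i => f (g ^+ i))).
rewrite -[in X in _ *+ X](card_ord c) -sumr_const; congr (_ + _); apply: eq_bigr => s _.
apply: eq_bigr => j _; rewrite addnC exprD mulnC exprM f_class //.
by rewrite expf_neq0 // (prim_root_neq0 g_prim).
Qed.

Lemma power_residueP (x : K) : x ^+ c = 1 -> exists u, x = u ^+ d.
Proof.
move=> xc1; have [|i x_gi] := prim_rootP g_prim (x := x).
  by rewrite mulnC exprM xc1 expr1n.
have : (d * c %| i * c)%N by rewrite (prim_order_dvd g_prim) exprM -x_gi xc1.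
rewrite dvdn_pmul2r // => /dvdnP[j i_jd].
by exists (g ^+ j); rewrite -exprM -i_jd.
Qed.

Lemma card_power_fibre (u : K) : u != 0 -> #|[set z : K | z ^+ d == u ^+ d]| = d.
Proof.
move=> u_neq0; pose zeta := g ^+ c.
have zeta_prim : d.-primitive_root zeta.
  by have := dvdn_prim_root g_prim (dvdn_mulr c (dvdnn d)); rewrite mulKn.
have -> : [set z : K | z ^+ d == u ^+ d] = [set u * zeta ^+ i | i : 'I_d].
  apply/setP => z; rewrite inE; apply/eqP/imsetP => [zd|[i _ ->]].
    have [|i zu_zeta] := prim_rootP zeta_prim (x := z / u).
      by rewrite expr_div_n zd divff // expf_neq0.
    by exists i; rewrite // -zu_zeta mulrC divfK.
  by rewrite exprMn exprAC (prim_expr_order zeta_prim) expr1n mulr1.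
rewrite card_imset ?card_ord // => i j /(mulfI u_neq0).
exact: prim_root_expr_inj zeta_prim i j.
Qed.

Lemma sum_expr n : (0 < n)%N -> \sum_(x : K) x ^+ n = - (d * c %| n)%:R.
Proof.
move=> n_gt0; have [dv|] := boolP (d * c %| n)%N; last first.
  rewrite (prim_order_dvd g_prim) -subr_eq0 => g_neq1; apply: (mulfI g_neq1).
  rewrite mulrN mulr0 oppr0 mulrBl mul1r mulr_sumr; apply/eqP; rewrite subr_eq0 eq_sym.
  rewrite (reindex_inj (mulfI (prim_root_neq0 g_prim))).
  by apply/eqP/eq_bigr => x _; rewrite exprMn.
have expr_n (x : K) : x != 0 -> x ^+ n = 1.
  by case/dvdnP: dv => e -> /expf_order x1; rewrite mulnC exprM x1 expr1n.
apply/eqP; rewrite -subr_eq0 opprK -[X in _ == X](card_natr0 K) (bigD1 0) //=.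
rewrite expr0n gtn_eqF // add0r; under eq_bigr => x x_neq0 do rewrite expr_n //.
by rewrite sumr_const cardC1 natr1 cardK.
Qed.

(* Only the exponents [i] of [z ^+ d] with [c %| i > 0] survive the summation. *)
Lemma sum_exprD_power (w : K) n :
  \sum_(z : K) (w + z ^+ d) ^+ (n * c) =
    - \sum_(j < n) w ^+ ((n - j.+1) * c) *+ 'C(n * c, j.+1 * c).
Proof.
transitivity (\sum_(i < (n * c).+1)
    (w ^+ (n * c - i) * \sum_(z : K) z ^+ (d * i)) *+ 'C(n * c, i)).
  under eq_bigr do rewrite exprDn; rewrite exchange_big; apply: eq_bigr => i _.
  by rewrite mulr_sumr -sumrMnl; apply: eq_bigr => z _; rewrite -exprM.
rewrite big_ord_recl muln0; under eq_bigr do rewrite expr0.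
rewrite sumr_const card_natr0 mulr0 mul0rn add0r -sumrN.
under eq_bigr => i _ do
  rewrite [lift _ _ : nat]/= sum_expr ?muln_gt0 ?d_gt0 // dvdn_pmul2l //.
rewrite mulnC (big_ord_mul _ c n (fun i =>
  (w ^+ (c * n - i.+1) * - (c %| i.+1)%:R) *+ 'C(c * n, i.+1))).
have last_lt : (c.-1 < c)%N by rewrite prednK.
apply: eq_bigr => s _; rewrite (bigD1 (Ordinal last_lt)) //= big1 ?addr0 => [|j].
  rewrite -addnS prednK // -mulnSr dvdn_mulr // mulrN1 -mulnBr mulNrn.
  by rewrite [in RHS]mulnC [in RHS](mulnC _ c).
rewrite -val_eqE /= => j_neq; rewrite -addnS dvdn_addr ?dvdn_mulr // gtnNdvd //.
  by rewrite oppr0 mulr0 mul0rn.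
by have := ltn_ord j; move: j_neq; clear; lia.
Qed.

End PowerClasses.

(** * Zeros of diagonal forms *)

Lemma card_set_sum (T : finType) (P : pred T) : #|[set x | P x]| = (\sum_x P x)%N.
Proof. by rewrite -sum1dep_card big_mkcond; apply: eq_bigr => x _; case: (P x). Qed.

Definition ffun_cons (T : Type) n (x : T) (f : {ffun 'I_n -> T}) : {ffun 'I_n.+1 -> T} :=
  [ffun i => oapp f x (unlift ord0 i)].

Section BigFfun.

Variables (R : Type) (idx : R) (op : Monoid.com_law idx).

Lemma big_ffun_cons (T : Type) n (x : T) (f : {ffun 'I_n -> T}) (h : T -> R) :
  \big[op/idx]_i h (ffun_cons x f i) = op (h x) (\big[op/idx]_i h (f i)).
Proof.
rewrite big_ord_recl ffunE unlift_none; congr (op _ _).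
by apply: eq_bigr => i _; rewrite ffunE liftK.
Qed.

Lemma big_ffun_ord0 (T : finType) (F : {ffun 'I_0 -> T} -> R) :
  \big[op/idx]_f F f = F (ffun0 (card_ord 0)).
Proof. by apply: big_pred1 => f; apply/esym/eqP/ffunP => -[]. Qed.

Lemma big_ffun_ordS (T : finType) n (F : {ffun 'I_n.+1 -> T} -> R) :
  \big[op/idx]_f F f = \big[op/idx]_x \big[op/idx]_f F (ffun_cons x f).
Proof.
rewrite pair_big (reindex (fun u => ffun_cons u.1 u.2)) //=.
exists (fun f : {ffun _} => (f ord0, [ffun i => f (lift ord0 i)])) => [[x f] _|f _] /=.
  congr (_, _); first by rewrite ffunE unlift_none.
  by apply/ffunP => i; rewrite !ffunE liftK.
by apply/ffunP => i; rewrite ffunE; case: unliftP => [j|] -> /=; rewrite ?ffunE.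
Qed.

End BigFfun.

Definition diag_zeros (K : finFieldType) (d n : nat) : nat :=
  #|[set x : {ffun 'I_n -> K} | \sum_j x j ^+ d == 0]|.

Lemma diag_zeros1 (K : finFieldType) d : (0 < d)%N -> diag_zeros K d 1 = 1%N.
Proof.
move=> d_gt0; rewrite /diag_zeros -[RHS](cards1 ([ffun=> 0] : {ffun 'I_1 -> K})).
apply: eq_card => x; rewrite !inE big_ord1 expf_eq0 d_gt0; apply/eqP/eqP => [x0|->].
  by apply/ffunP => j; rewrite ord1 ffunE.
by rewrite ffunE.
Qed.

Section DiagonalZeros.

Variables (K : finFieldType) (d c : nat) (g : K).
Hypotheses (cardK : #|K| = (d * c).+1) (g_prim : (d * c).-primitive_root g).

Let order_gt0 : (0 < d * c)%N := prim_order_gt0 g_prim.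

Lemma diag_zeros2 : odd d -> diag_zeros K d 2 = (1 + d * c * d)%N.
Proof.
move=> d_odd; rewrite /diag_zeros card_set_sum big_ffun_ordS.
have fibre x : (\sum_(f : {ffun 'I_1 -> K}) (\sum_j ffun_cons x f j ^+ d == 0)%R =
    #|[set z : K | z ^+ d == (- x) ^+ d]|)%N.
  rewrite card_set_sum big_ffun_ordS; apply: eq_bigr => z _; rewrite big_ffun_ord0.
  rewrite !(big_ffun_cons _ _ _ (fun z => z ^+ d)) big_ord0 /= addr0.
  by rewrite exprNn -signr_odd d_odd mulN1r -addr_eq0 addrC.
under eq_bigr do rewrite fibre; rewrite (bigD1 0) //=; congr (_ + _)%N.
  rewrite -[RHS](cards1 (0 : K)); apply: eq_card => z; rewrite !inE oppr0.
  by rewrite expr0n gtn_eqF ?odd_gt0 // expf_eq0 odd_gt0.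
under eq_bigr => x x_neq0 do rewrite (card_power_fibre g_prim) ?oppr_eq0 //.
by rewrite sum_nat_const cardC1 cardK.
Qed.

Lemma sum_diag_form_expr k n (w : K) : (n <= k)%N ->
  \sum_(x : {ffun 'I_k -> K}) (w + \sum_j x j ^+ d) ^+ (n * c) =
    (n == k)%:R * (-1) ^+ k * (\prod_(i < k) 'C(i.+1 * c, c))%:R.
Proof.
elim: k n w => [|k IHk] n w.
  by rewrite leqn0 => /eqP->; rewrite big_ffun_ord0 big_ord0 !mulr1.
move=> le_nk; rewrite big_ffun_ordS exchange_big /=.
transitivity (- \sum_(j < n) (\sum_(x : {ffun 'I_k -> K})
    (w + \sum_i x i ^+ d) ^+ ((n - j.+1) * c)) *+ 'C(n * c, j.+1 * c)).
  under [in RHS]eq_bigr do rewrite -sumrMnl.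
  rewrite [in RHS]exchange_big -sumrN; apply: eq_bigr => x _ /=.
  rewrite -(sum_exprD_power cardK g_prim); apply: eq_bigr => z _.
  by rewrite (big_ffun_cons _ _ _ (fun z => z ^+ d)) addrAC addrA.
case: n le_nk => [|n le_nk]; first by rewrite big_ord0 oppr0 !mul0r.
rewrite big_ord_recl [X in _ + X]big1 ?addr0 => [|j _]; last first.
  by rewrite IHk ?ltn_eqF ?mul0r ?mul0rn // lift0; have := ltn_ord j; lia.
rewrite subSS subn0 mul1n IHk // eqSS [in RHS]big_ord_recr natrM exprS -mulr_natr.
by case: eqP => [->|_]; rewrite ?mul0r ?oppr0 // !mul1r mulN1r mulrA !mulNr.
Qed.

Lemma natr_diag_zeros :
  (diag_zeros K d d)%:R = (-1) ^+ d.+1 * (\prod_(i < d) 'C(i.+1 * c, c))%:R :> K.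
Proof.
have indicator (x : K) : (x == 0)%:R = 1 - x ^+ (d * c).
  have [->|x_neq0] := eqVneq x 0; last by rewrite (expf_order cardK) ?subrr.
  by rewrite expr0n gtn_eqF ?subr0.
rewrite /diag_zeros card_set_sum natr_sum; under eq_bigr do rewrite indicator.
rewrite sumrB sumr_const card_ffun card_ord natrX card_natr0 expr0n.
move: order_gt0; rewrite muln_gt0 => /andP[d_gt0 _]; rewrite gtn_eqF // sub0r.
under eq_bigr do rewrite -[X in X ^+ _]add0r.
by rewrite sum_diag_form_expr // eqxx mul1r exprS mulN1r mulNr.
Qed.

End DiagonalZeros.

Lemma fact_mul_prod d c : ((d * c)`! = (\prod_(i < d) 'C(i.+1 * c, c)) * c`! ^ d)%N.
Proof.
elim: d => [|d IHd]; first by rewrite mul0n big_ord0.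
have le_c : (c <= d.+1 * c)%N by rewrite leq_pmull.
rewrite -(bin_fact le_c) {2}mulSn addKn IHd big_ord_recr expnS /=; lia.
Qed.

Lemma logn_fact_widen p n k : prime p -> (n <= k)%N ->
  logn p n`! = (\sum_(1 <= i < k.+1) n %/ p ^ i)%N.
Proof.
move=> p_pr le_nk; rewrite logn_fact // [RHS](@big_cat_nat _ _ _ n.+1) //=.
rewrite [X in (_ = _ + X)%N]big_nat_cond [X in (_ = _ + X)%N]big1 ?addn0 // => i.
rewrite andbT => /andP[lt_ni _]; rewrite divn_small //.
by apply: ltn_trans lt_ni _; apply: ltn_expl; apply: prime_gt1.
Qed.

Lemma modn_exp1 p d n : (p %% d = 1 -> p ^ n %% d = 1)%N.
Proof. by move=> p1; rewrite -modnXm p1 exp1n; case: d p1 => [|[]] //; rewrite modn1. Qed.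

(* In base [p] all digits of [c = (p ^ m - 1) / d] are [(p - 1) / d], so adding
   [d] copies of [c] produces no carry. *)
Lemma logn_fact_no_carry p d m c : prime p -> (p %% d = 1)%N ->
  (p ^ m = (d * c).+1)%N -> (logn p (d * c)`! = d * logn p c`!)%N.
Proof.
move=> p_pr p_mod_d pm_dc; have d_gt0 : (0 < d)%N.
  by case: d p_mod_d {pm_dc} => // p0; move: p_pr; rewrite -[p]modn0 p0.
rewrite logn_fact // (@logn_fact_widen p c (d * c)) ?leq_pmull // big_distrr /=.
apply: eq_big_nat => i _; have [le_mi|lt_im] := leqP m i.
  have := leq_pexp2l (prime_gt0 p_pr) le_mi; rewrite pm_dc => lt_dc.
  by rewrite !divn_small ?muln0 //; apply: leq_ltn_trans lt_dc; rewrite leq_pmull.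
have := divn_eq (p ^ i) d; rewrite modn_exp1 //.
have := divn_eq (p ^ (m - i)) d; rewrite modn_exp1 //.
set e := (p ^ i %/ d)%N; set f := (p ^ (m - i) %/ d)%N => pmi_fd pi_ed.
have := expnD p (m - i) i; rewrite subnK ?(ltnW lt_im) // pm_dc pi_ed pmi_fd => dc_fe.
have -> : (c = f * (e * d + 1) + e)%N.
  by apply/eqP; rewrite -(eqn_pmul2l d_gt0); move: dc_fe; clear; lia.
by rewrite mulnDr mulnA !divnMDl ?addn1 // !divn_small ?addn0 // ltnS ?leq_pmulr // mulnC.
Qed.

Lemma prime_Ndvd_prod_bin p d m c : prime p -> (p %% d = 1)%N ->
  (p ^ m = (d * c).+1)%N -> ~~ (p %| \prod_(i < d) 'C(i.+1 * c, c))%N.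
Proof.
move=> p_pr p_mod_d pm_dc; have := logn_fact_no_carry p_pr p_mod_d pm_dc.
have prod_gt0 : (0 < \prod_(i < d) 'C(i.+1 * c, c))%N.
  by apply: prodn_gt0 => i; rewrite bin_gt0 leq_pmull.
rewrite fact_mul_prod lognM ?expn_gt0 ?fact_gt0 // lognX => /(canRL (addnK _)).
by rewrite subnn -[X in (X %| _)%N]expn1 pfactor_dvdn // => ->.
Qed.

Lemma prime_Ndvd_diag_zeros (K : finFieldType) p d m c (g : K) :
  prime p -> (p %% d = 1)%N -> #|K| = (p ^ m)%N -> (p ^ m = (d * c).+1)%N ->
  (d * c).-primitive_root g -> ~~ (p %| diag_zeros K d d)%N.
Proof.
move=> p_pr p_mod_d cardK order_K g_prim; have pcharKp := card_finPcharP cardK p_pr.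
have cardK_order : #|K| = (d * c).+1 by rewrite cardK.
rewrite (dvdn_pcharf pcharKp) (natr_diag_zeros cardK_order g_prim) mulf_eq0 signr_eq0.
by rewrite -(dvdn_pcharf pcharKp) (prime_Ndvd_prod_bin p_pr p_mod_d order_K).
Qed.

(** * Exponential sums over powers *)

Definition power_weight (K : finFieldType) (p m d c : nat) (g y : K) : nat :=
  #|[set s : 'I_c | trace_abs p m (y * g ^+ (d * s)) != 0]|.

Definition power_sum (K : finFieldType) (p m d : nat) (xi : algC) (y : K) : algC :=
  \sum_(x : K) add_char p m xi (y * x ^+ d).

Lemma Psi_mod (r q i : nat) : (q %% r = 1 -> Psi i q = i %[mod r])%N.
Proof.
move=> q_mod_r; rewrite /Psi; elim: i => [|i IHi]; first by rewrite big_ord0.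
by rewrite big_ord_recr /= -modnDm IHi modn_exp1 // modnDml addn1.
Qed.

Section PowerSums.

Variables (K : finFieldType) (p m d c : nat) (g : K).
Hypotheses (p_pr : prime p) (p_mod_d : (p %% d = 1)%N) (dvd_dm : (d %| m)%N).
Hypotheses (cardK : #|K| = (p ^ m)%N) (order_K : (p ^ m = (d * c).+1)%N).
Hypothesis g_prim : (d * c).-primitive_root g.

Local Notation q := (p ^ m)%N.
Local Notation weight := (power_weight p m d c g).

Let cardK_order : #|K| = (d * c).+1.
Proof. by rewrite cardK. Qed.

Let pcharKp : p \in [pchar K] := card_finPcharP cardK p_pr.

Let d_gt0 : (0 < d)%N.
Proof. by have := prim_order_gt0 g_prim; rewrite muln_gt0 => /andP[]. Qed.

Lemma dvdn_pred_order : (p.-1 %| c)%N.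
Proof.
have /dvdnP[e Psi_ed] : (d %| Psi m p)%N by rewrite /dvdn Psi_mod.
have /eqP : (d * c = d * (e * p.-1))%N.
  rewrite -[LHS]/(d * c).+1.-1 -order_K predn_exp -/(Psi m p) Psi_ed.
  by rewrite mulnA mulnC (mulnC e).
by rewrite eqn_pmul2l // => /eqP->; apply: dvdn_mull.
Qed.

Lemma natr_power_residue s : (s < p.-1)%N -> exists2 u : K, u != 0 & s.+1%:R = u ^+ d.
Proof.
move=> lt_s; have s_neq0 : s.+1%:R != 0 :> K.
  by rewrite -(dvdn_pcharf pcharKp) gtnNdvd // -ltn_predRL.
have [|u s_ud] := power_residueP g_prim (x := s.+1%:R).
  have /dvdnP[e ->] := dvdn_pred_order.
  rewrite mulnC exprM (_ : _ ^+ p.-1 = 1) ?expr1n //; apply: (mulfI s_neq0).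
  rewrite -exprS prednK ?prime_gt0 // mulr1.
  by rewrite -(pFrobenius_autE pcharKp) pFrobenius_aut_nat.
exists u => //; apply: contraNneq s_neq0 => u0.
by rewrite s_ud u0 expr0n gtn_eqF.
Qed.

Lemma sum_trace_power_eq0 (y : K) :
  (\sum_(x : K) (trace_abs p m (y * x ^+ d) == 0)%R + d * weight y = q)%N.
Proof.
have -> : (\sum_(x : K) (trace_abs p m (y * x ^+ d) == 0)%R =
    1 + d * \sum_(s < c) (trace_abs p m (y * g ^+ (d * s)) == 0)%R)%N.
  rewrite (sum_powers cardK_order g_prim (fun x => (trace_abs p m (y * x) == 0) : nat)).
  by rewrite mulr0 trace_abs0 ?pnatE // eqxx -mulr_natl natn.
rewrite /power_weight card_set_sum -addnA -mulnDr -big_split /=.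
under eq_bigr do rewrite addnC addn_negb.
by rewrite sum_nat_const card_ord muln1 order_K.
Qed.

Section Character.

Variable xi : algC.
Hypothesis xi_prim : p.-primitive_root xi.

Local Notation psi := (@add_char K p m xi).
Local Notation G := (@power_sum K p m d xi).

Let psi0 := add_char0 p_pr cardK xi_prim.

Lemma power_sum0 : G 0 = q%:R.
Proof. by rewrite /G; under eq_bigr do rewrite mul0r psi0; rewrite sumr_const cardK. Qed.

Lemma power_sum_class (y u : K) : u != 0 -> G (y * u ^+ d) = G y.
Proof.
move=> u_neq0; rewrite [RHS](reindex_inj (mulfI u_neq0)).
by apply: eq_bigr => x _; rewrite exprMn mulrA.
Qed.

Lemma power_sum_moment n : \sum_y G y ^+ n = q%:R * (diag_zeros K d n)%:R.
Proof.
transitivity (\sum_(x : {ffun 'I_n -> K}) \sum_y psi (y * \sum_j x j ^+ d)).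
  rewrite exchange_big; apply: eq_bigr => y _ /=.
  rewrite -[in LHS](card_ord n) -prodr_const bigA_distr_bigA; apply: eq_bigr => x _.
  by rewrite mulr_sumr (add_char_sum p_pr cardK xi_prim).
under eq_bigr do rewrite (sum_add_char p_pr cardK xi_prim) cardK.
by rewrite -mulr_sumr /diag_zeros card_set_sum natr_sum.
Qed.

Lemma power_sum_class_moment n :
  q%:R ^+ n + (\sum_(i < d) G (g ^+ i) ^+ n) *+ c = q%:R * (diag_zeros K d n)%:R.
Proof.
rewrite -power_sum_moment (sum_power_classes cardK_order g_prim (f := fun y => G y ^+ n)).
  by rewrite power_sum0.
by move=> y u u_neq0; rewrite power_sum_class.
Qed.

(* Every nonzero element of the prime subfield is a [d]-th power, so [G] is
   invariant under it; summing over the prime subfield makes the trace condition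
   appear. *)
Lemma power_sum_weight (y : K) :
  d%:R * p%:R * (weight y)%:R = p.-1%:R * (q%:R - G y).
Proof.
have p_gt0 := prime_gt0 p_pr.
have pG : p.-1%:R * G y = \sum_x (p%:R * (trace_abs p m (y * x ^+ d) == 0)%:R - 1).
  transitivity (\sum_(s < p.-1) G (y * s.+1%:R)).
    rewrite -[p.-1 in LHS]card_ord mulr_natl -sumr_const; apply: eq_bigr => s _.
    by have [u u_neq0 ->] := natr_power_residue (ltn_ord s); rewrite power_sum_class.
  rewrite exchange_big; apply: eq_bigr => x _ /=.
  rewrite -(sum_add_charMn p_pr cardK xi_prim); apply: eq_bigr => s _.
  by rewrite mulr_natr mulrnAl.
have p_pred : p.-1%:R = p%:R - 1 :> algC by rewrite -subn1 natrB.
rewrite mulrBr pG sumrB sumr_const cardK -mulr_sumr -natr_sum p_pred.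
by rewrite -(sum_trace_power_eq0 y) natrD natrM; ring.
Qed.

Lemma power_sum_int (y : K) : exists e : int, G y = (1 + d%:Z * e)%:~R.
Proof.
pose period := \sum_(s < c) psi (y * g ^+ (d * s)).
have G_period : G y = 1 + d%:R * period.
  rewrite /G /power_sum (sum_powers cardK_order g_prim (fun x => psi (y * x))).
  by rewrite mulr0 psi0 mulr_natl.
have d_neq0 : d%:R != 0 :> algC by rewrite pnatr_eq0 -lt0n.
have pred_p_neq0 : p.-1%:R != 0 :> algC.
  by rewrite pnatr_eq0 -lt0n -ltnS prednK ?prime_gt0 ?prime_gt1.
suff /intrP[e period_e] : period \in Num.int.
  by exists e; rewrite G_period period_e rmorphD rmorphM.
apply: Cint_rat_Aint; last by apply: rpred_sum => s _; apply: Aint_add_char xi_prim _.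
have -> : period = (q%:R - d%:R * p%:R * (weight y)%:R / p.-1%:R - 1) / d%:R.
  by rewrite power_sum_weight G_period; field; rewrite d_neq0.
by rewrite !(rpredM, rpredB, rpred_nat, rpredV, rpred1).
Qed.

End Character.

Lemma exists_integral_power_sums : exists G : K -> int,
  [/\ forall y, d%:Z * p%:Z * (weight y)%:Z = p.-1%:Z * (q%:Z - G y),
      forall y, (d %| G y - 1)%Z,
      forall y u, u != 0 -> G (y * u ^+ d) = G y
    & forall n, q%:Z ^+ n + (\sum_(i < d) G (g ^+ i) ^+ n) *+ c =
        q%:Z * (diag_zeros K d n)%:Z].
Proof.
have [xi xi_prim] := C_prim_root_exists (prime_gt0 p_pr).
pose G (y : K) : int := Num.floor (power_sum p m d xi y).
have GE y : (G y)%:~R = power_sum p m d xi y.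
  by have [e G_e] := power_sum_int xi_prim y; rewrite /G G_e intrKfloor.
have inj : injective (intr : int -> algC) by apply: intr_inj.
exists G; split=> [y|y|y u u_neq0|n].
- by apply: inj; rewrite !(rmorphM, rmorphB) /= GE -power_sum_weight.
- have [e G_e] := power_sum_int xi_prim y; have := GE y; rewrite G_e => /inj->.
  by rewrite addrC addKr dvdz_mulr.
- by rewrite /G power_sum_class.
apply: inj; rewrite rmorphD rmorphM rmorphMn rmorphXn rmorph_sum /=.
apply: etrans (power_sum_class_moment xi_prim n); congr (_ + _ *+ _).
by apply: eq_bigr => i _; rewrite rmorphXn /= GE.
Qed.

End PowerSums.

(** * Representations by [x ^ 2 + D y ^ 2] *)

Section PrimePowerDivisibility.

Variables (p t : nat).
Hypothesis p_pr : prime p.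

Lemma Euclid_dvdzM (x y : int) : (p %| x * y)%Z = (p %| x)%Z || (p %| y)%Z.
Proof. by rewrite !dvdzE abszM /= Euclid_dvdM. Qed.

Lemma coprimez_prime_exp (x : int) : ~~ (p %| x)%Z -> coprimez (p%:Z ^+ t) x.
Proof. by rewrite dvdzE => pNx; rewrite coprimezXl // coprimezE prime_coprime. Qed.

Lemma prime_exp_dvdzM (x y : int) : ~~ ((p %| x) && (p %| y))%Z ->
  (p%:Z ^+ t %| x * y)%Z -> (p%:Z ^+ t %| x)%Z || (p%:Z ^+ t %| y)%Z.
Proof.
rewrite negb_and => /orP[] /coprimez_prime_exp co_pt.
  by rewrite Gauss_dvdzr // => ->; rewrite orbT.
by rewrite Gauss_dvdzl // => ->.
Qed.

End PrimePowerDivisibility.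

Lemma repr_sum_sq_cross_eq (D P a b a' b' : int) :
  16 < D -> 0 < P -> 4 * P = a ^+ 2 + D * b ^+ 2 -> 4 * P = a' ^+ 2 + D * b' ^+ 2 ->
  (P %| a * b' - a' * b)%Z -> a * b' = a' * b.
Proof.
move=> D_gt16 P_gt0 reprP reprP' /dvdzP[x cross_x].
have brahmagupta : (a * a' + D * b * b') ^+ 2 + P ^+ 2 * (D * x ^+ 2) = P ^+ 2 * 16.
  transitivity ((4 * P) * (4 * P)); last by ring.
  rewrite {1}reprP reprP' (_ : P ^+ 2 * _ = D * (a * b' - a' * b) ^+ 2); first by ring.
  by rewrite cross_x; ring.
have : P ^+ 2 * (D * x ^+ 2) <= P ^+ 2 * 16 by rewrite -brahmagupta lerDr sqr_ge0.
rewrite (ler_pM2l (exprn_gt0 2 P_gt0)) => Dx2_le16.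
suff x0 : x = 0 by apply/eqP; rewrite -subr_eq0 cross_x x0 mul0r.
apply: contraTeq Dx2_le16; rewrite -ltNge -sqrf_eq0 => x2_neq0.
have x2_gt0 : 0 < x ^+ 2 by rewrite lt0r x2_neq0 sqr_ge0.
by apply: (lt_le_trans D_gt16); rewrite ler_peMr; move: D_gt16 x2_gt0; clear; lia.
Qed.

(* If both representations hold then [p ^ t] divides [D (a b' - a' b) (a b' + a' b)],
   hence one of the two last factors, which must then vanish. *)
Lemma repr_sum_sq_unique (p t : nat) (D a b a' b' : int) :
  prime p -> odd p -> (0 < t)%N -> 16 < D -> ~~ (p %| D)%Z ->
  4 * p%:Z ^+ t = a ^+ 2 + D * b ^+ 2 -> 4 * p%:Z ^+ t = a' ^+ 2 + D * b' ^+ 2 ->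
  ~~ (p %| a)%Z -> ~~ (p %| a')%Z -> a' ^+ 2 = a ^+ 2.
Proof.
move=> p_pr p_odd t_gt0 D_gt16 pND; set P := p%:Z ^+ t => reprP reprP' pNa pNa'.
have P_gt0 : 0 < P by rewrite exprn_gt0 // ltz_nat prime_gt0.
have p_dvd_P : (p %| P)%Z by rewrite /P -(prednK t_gt0) exprS dvdz_mulr.
have pNb' : ~~ (p %| b')%Z.
  apply: contra pNa' => p_dvd_b'; have : (p %| a' ^+ 2)%Z.
    by rewrite -(addrK (D * b' ^+ 2) (a' ^+ 2)) -reprP' rpredB // dvdz_mull // dvdz_mulr.
  by rewrite expr2 Euclid_dvdzM // orbb.
have not_both : ~~ ((p %| a * b' - a' * b) && (p %| a * b' + a' * b))%Z.
  apply/negP => /andP[dvd_sub dvd_add].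
  have := rpredD dvd_sub dvd_add; rewrite addrCA subrK -mulr2n -mulr_natl natz.
  rewrite !Euclid_dvdzM // (negPf pNa) (negPf pNb') !orbF dvdzE /=.
  by rewrite dvdn_prime2 //; case: eqP p_odd => // ->.
have dvd_prod : (P %| (a * b' - a' * b) * (a * b' + a' * b))%Z.
  rewrite -(Gauss_dvdzr _ (coprimez_prime_exp t p_pr pND)); apply/dvdzP.
  exists (4 * (a ^+ 2 - a' ^+ 2)).
  transitivity (a ^+ 2 * (4 * P) - a' ^+ 2 * (4 * P)); last by rewrite -/P; ring.
  by rewrite {1}reprP' reprP; ring.
have cross_sq : (a * b') ^+ 2 = (a' * b) ^+ 2.
  case/orP: (prime_exp_dvdzM p_pr not_both dvd_prod) => [dvd_sub|dvd_add].
    by rewrite (repr_sum_sq_cross_eq D_gt16 P_gt0 reprP reprP').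
  rewrite -[RHS]sqrrN -mulrN; congr (_ ^+ 2).
  by apply: (repr_sum_sq_cross_eq D_gt16 P_gt0 _ reprP'); rewrite ?sqrrN ?mulrN ?opprK.
apply: (@mulfI _ (4 * P)); first by rewrite mulf_neq0 ?gt_eqF.
rewrite {1}reprP reprP' !mulrDl -[D * b ^+ 2 * _]mulrA -[D * b' ^+ 2 * _]mulrA.
by rewrite -!exprMn ![b * _]mulrC ![b' * _]mulrC cross_sq [a' * a]mulrC.
Qed.

(** * The cubic exponential sums *)

Lemma dvdz_cubic_roots (P x y z : int) :
  x + y + z = 0 -> x ^+ 2 + y ^+ 2 + z ^+ 2 = 6 * P ^+ 3 -> (P ^+ 3 %| x * y * z)%Z ->
  [/\ (P %| x)%Z, (P %| y)%Z & (P %| z)%Z].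
Proof.
move=> sum0 sum_sq dvd_xyz; have z_xy : z = - (x + y) by move: sum0; clear; lia.
have sym2E : P ^+ 3 * 3 = x ^+ 2 + x * y + y ^+ 2.
  by rewrite z_xy in sum_sq; move: sum_sq; clear; lia.
have root_dvd u : u ^+ 3 = P ^+ 3 * 3 * u + x * y * z -> (P %| u)%Z.
  by rewrite -(@dvdz_pexp2r _ _ 3) // => ->; rewrite rpredD // -mulrA dvdz_mulr.
by split; apply: root_dvd; rewrite sym2E z_xy; ring.
Qed.

Lemma prod_of_cubic_power_sums (q M x y z : int) (c : nat) :
  q = 3 * c%:Z + 1 -> x + y + z = 0 ->
  q ^+ 3 + (x ^+ 3 + y ^+ 3 + z ^+ 3) *+ c = q * M ->
  x * y * z = q * (q ^+ 2 + x * y * z - M).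
Proof.
move=> order_q sum0 sum_cube; have z_xy : z = - (x + y) by move: sum0; clear; lia.
by rewrite mulrBr -sum_cube -mulr_natr natz order_q z_xy; ring.
Qed.

Lemma eqz_mod9_pair (x y z : int) :
  (3 %| x - 1)%Z -> (3 %| y - 1)%Z -> (3 %| z - 1)%Z -> x + y + z = 0 ->
  [\/ (9 %| y - z)%Z, (9 %| x - z)%Z | (9 %| x - y)%Z].
Proof.
move=> x_mod3 y_mod3 z_mod3 sum0.
have [|yz_mod9] := boolP (9 %| y - z)%Z; first by constructor 1.
have [|xz_mod9] := boolP (9 %| x - z)%Z; first by constructor 2.
by constructor 3; move: yz_mod9 xz_mod9 sum0 x_mod3 y_mod3 z_mod3; clear; lia.
Qed.

(* The doubles of [a], [- (a + 9 b) / 2] and [- (a - 9 b) / 2], to stay within [int]. *)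
Definition cubic_triple (a b : int) : seq int :=
  [:: 2 * a; - (a + 9 * b); - (a - 9 * b)].

Lemma Posz_expnM (p s t : nat) : (p ^ (s * t))%N%:Z = (p%:Z ^+ t) ^+ s.
Proof. by rewrite -exprM mulnC -[LHS]natz natrX natz. Qed.

Section CubicValues.

Variables (p t : nat) (a b : int).
Hypotheses (p_pr : prime p) (p_mod3 : (p %% 3 = 1)%N) (t_gt0 : (0 < t)%N).

Local Notation P := (p%:Z ^+ t).

Hypotheses (reprP : 4 * P = a ^+ 2 + 27 * b ^+ 2) (a_mod3 : (a %% 3)%Z = 1).
Hypothesis pNa : ~~ (p %| a)%Z.

Lemma repr27_unique (x y : int) :
  4 * P = x ^+ 2 + 27 * y ^+ 2 -> (3 %| x - 1)%Z -> ~~ (p %| x)%Z ->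
  x = a /\ (y = b \/ y = - b).
Proof.
move=> reprP' x_mod3 pNx.
have p_odd : odd p by case: (even_prime p_pr) => // p2; move: p_mod3; rewrite p2.
have pN27 : ~~ (p %| 27)%Z.
  rewrite dvdzE /= (Euclid_dvdX 3 3) // andbT dvdn_prime2 //.
  by apply: contra_eqN p_mod3 => /eqP->.
have x_sq : x ^+ 2 = a ^+ 2.
  exact: (repr_sum_sq_unique p_pr p_odd t_gt0 _ pN27 reprP reprP').
have xa : x = a.
  move/eqP: x_sq; rewrite eqf_sqr => /orP[/eqP//|/eqP xNa].
  by move: xNa a_mod3 x_mod3; clear; lia.
split=> //; have /eqP : y ^+ 2 = b ^+ 2.
  by move: reprP'; rewrite reprP xa => /addrI /mulfI ->.
by rewrite eqf_sqr => /orP[] /eqP; [left | right].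
Qed.

(* [x + y + z = 0] and [y - z = 9 d] turn [x ^ 2 + y ^ 2 + z ^ 2 = 6 P] into
   [4 P = x ^ 2 + 27 d ^ 2]. *)
Lemma repr27_triple_of_pair (x y z : int) :
  (9 %| y - z)%Z -> (3 %| x - 1)%Z -> ~~ (p %| x)%Z ->
  x + y + z = 0 -> x ^+ 2 + y ^+ 2 + z ^+ 2 = 6 * P ->
  perm_eq [:: 2 * x; 2 * y; 2 * z] (cubic_triple a b).
Proof.
case/dvdzP=> d yz_9d x_mod3 pNx sum0 sum_sq.
have [|x_a d_b] := @repr27_unique x d _ x_mod3 pNx.
  have z_xy : z = - (x + y) by move: sum0; clear; lia.
  have x_dy : x = d * 9 - 2 * y by move: yz_9d sum0; clear; lia.
  by rewrite z_xy x_dy in sum_sq; rewrite x_dy; move: sum_sq; clear; lia.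
have -> : 2 * y = - (a - 9 * d) by rewrite -x_a; move: yz_9d sum0; clear; lia.
have -> : 2 * z = - (a + 9 * d) by rewrite -x_a; move: yz_9d sum0; clear; lia.
rewrite x_a perm_cons; case: d_b => ->; first by rewrite (perm_catC [:: _] [:: _]).
by rewrite mulrN opprK.
Qed.

Lemma repr27_triple (x y z : int) :
  (3 %| x - 1)%Z -> (3 %| y - 1)%Z -> (3 %| z - 1)%Z -> ~~ (p %| x * y * z)%Z ->
  x + y + z = 0 -> x ^+ 2 + y ^+ 2 + z ^+ 2 = 6 * P ->
  perm_eq [:: 2 * x; 2 * y; 2 * z] (cubic_triple a b).
Proof.
move=> x_mod3 y_mod3 z_mod3; rewrite !Euclid_dvdzM // !negb_or -andbA.
case/and3P=> pNx pNy pNz sum0 sum_sq.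
case: (eqz_mod9_pair x_mod3 y_mod3 z_mod3 sum0) => dvd9.
- exact: repr27_triple_of_pair.
- rewrite (perm_catCA [:: _] [:: _]) repr27_triple_of_pair //.
    by rewrite (addrC y).
  by rewrite (addrC (y ^+ 2)).
- rewrite -(perm_rot 2) repr27_triple_of_pair //; first by rewrite -addrA addrC.
  by rewrite -addrA addrC.
Qed.

Lemma cubic_power_sum_values (c M : nat) (x y z : int) :
  (p ^ (3 * t) = (3 * c).+1)%N -> ~~ (p %| M)%N ->
  (3 %| x - 1)%Z -> (3 %| y - 1)%Z -> (3 %| z - 1)%Z ->
  x + y + z = 0 -> x ^+ 2 + y ^+ 2 + z ^+ 2 = 6 * P ^+ 3 ->
  (P ^+ 3) ^+ 3 + (x ^+ 3 + y ^+ 3 + z ^+ 3) *+ c = P ^+ 3 * M%:Z ->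
  perm_eq [:: 2 * x; 2 * y; 2 * z] [seq P * s | s <- cubic_triple a b].
Proof.
move=> order_q pNM x_mod3 y_mod3 z_mod3 sum0 sum_sq sum_cube.
have P_neq0 : P != 0 by rewrite expf_neq0 // eqz_nat -lt0n prime_gt0.
have P3_order : P ^+ 3 = 3 * c%:Z + 1 by rewrite -Posz_expnM order_q; lia.
have prodE := prod_of_cubic_power_sums P3_order sum0 sum_cube.
have [] := dvdz_cubic_roots sum0 sum_sq; first by rewrite prodE dvdz_mulr.
move=> /dvdzP[u xE] /dvdzP[v yE] /dvdzP[w zE]; subst x y z.
have P_mod3 : (3 %| P - 1)%Z by rewrite -eqz_mod_dvd -modzXm modz_nat p_mod3 expr1n.
have mod3 k : (3 %| k * P - 1)%Z -> (3 %| k - 1)%Z.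
  have -> : k - 1 = (k * P - 1) - k * (P - 1) by ring.
  by move=> kP_mod3; rewrite rpredB // dvdz_mull.
have uvwE : u * v * w = (P ^+ 3) ^+ 2 + P ^+ 3 * (u * v * w) - M%:Z.
  apply: (mulfI (expf_neq0 3 P_neq0)).
  transitivity (u * P * (v * P) * (w * P)); [|rewrite prodE]; ring.
have pNuvw : ~~ (p %| u * v * w)%Z.
  have p_dvd_P3 : (p %| P ^+ 3)%Z by rewrite -(prednK t_gt0) !exprS -!mulrA dvdz_mulr.
  rewrite uvwE rpredBl; first exact: pNM.
  by apply: rpredD; [apply: dvdz_exp | apply: dvdz_mulr].
have sum0_uvw : u + v + w = 0.
  by apply: (mulIf P_neq0); rewrite mul0r -sum0; ring.
have sum_sq_uvw : u ^+ 2 + v ^+ 2 + w ^+ 2 = 6 * P.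
  apply: (mulfI (expf_neq0 2 P_neq0)).
  by transitivity (6 * P ^+ 3); [rewrite -sum_sq|]; ring.
have -> : [:: 2 * (u * P); 2 * (v * P); 2 * (w * P)] =
    [seq P * s | s <- [:: 2 * u; 2 * v; 2 * w]] by congr [:: _; _; _]; ring.
exact/perm_map/(repr27_triple (mod3 u x_mod3) (mod3 v y_mod3) (mod3 w z_mod3)).
Qed.

End CubicValues.

Lemma power_weight0 (K : finFieldType) (p m d c : nat) (g : K) :
  p \in [pchar K] -> power_weight p m d c g 0 = 0%N.
Proof.
move=> pcharKp; rewrite /power_weight card_set_sum big1 // => s _.
by rewrite mul0r trace_abs0 ?eqxx // pnatE ?(pcharf_prime pcharKp).
Qed.

Section CubicWeightEnumerator.

Variables (K : finFieldType) (p t c : nat) (g : K) (a b : int).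
Hypotheses (p_pr : prime p) (p_mod3 : (p %% 3 = 1)%N) (t_gt0 : (0 < t)%N).
Hypotheses (cardK : #|K| = (p ^ (3 * t))%N) (order_K : (p ^ (3 * t) = (3 * c).+1)%N).
Hypothesis g_prim : (3 * c).-primitive_root g.
Hypothesis reprP : 4 * p%:Z ^+ t = a ^+ 2 + 27 * b ^+ 2.
Hypotheses (a_mod3 : (a %% 3)%Z = 1) (pNa : ~~ (p %| a)%Z).

Local Notation P := (p%:Z ^+ t).
Local Notation weight := (power_weight p (3 * t) 3 c g).

Let cardK_order : #|K| = (3 * c).+1.
Proof. by rewrite cardK. Qed.

Let c_gt0 : (0 < c)%N.
Proof. by have := prim_order_gt0 g_prim; rewrite muln_gt0. Qed.

Lemma exists_cubic_power_sums : exists G : K -> int,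
  [/\ forall y, 3 * p%:Z * (weight y)%:Z = p.-1%:Z * (P ^+ 3 - G y),
      forall y u, u != 0 -> G (y * u ^+ 3) = G y
    & perm_eq [:: 2 * G 1; 2 * G g; 2 * G (g ^+ 2)]
        [seq P * s | s <- cubic_triple a b]].
Proof.
have [G [weightG G_mod3 G_class moment]] :=
  exists_integral_power_sums p_pr p_mod3 (dvdn_mulr t (dvdnn 3)) cardK order_K g_prim.
rewrite Posz_expnM in weightG moment.
have moment3 n : (P ^+ 3) ^+ n + (G 1 ^+ n + G g ^+ n + G (g ^+ 2) ^+ n) *+ c =
    P ^+ 3 * (diag_zeros K 3 n)%:Z.
  by rewrite -moment !big_ord_recl big_ord0 addr0 addrA.
have P3_order : P ^+ 3 = 3 * c%:Z + 1 by rewrite -Posz_expnM order_K; lia.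
have c_neq0 : c%:Z != 0 by rewrite eqz_nat -lt0n.
have pNzeros := prime_Ndvd_diag_zeros p_pr p_mod3 cardK order_K g_prim.
exists G; split=> //.
apply: (cubic_power_sum_values p_pr p_mod3 t_gt0 reprP a_mod3 pNa order_K pNzeros
  (G_mod3 1) (G_mod3 g) (G_mod3 (g ^+ 2))); last exact: moment3.
  have := moment3 1%N; rewrite diag_zeros1 // !expr1 mulr1 -[RHS]addr0 => /addrI/eqP.
  by rewrite mulrn_eq0 gtn_eqF // => /eqP.
apply: (mulfI c_neq0); have := moment3 2%N; rewrite (diag_zeros2 cardK_order g_prim) //.
by rewrite -mulr_natl natz => /(canRL (addKr _))->; rewrite P3_order PoszD !PoszM; ring.
Qed.

Lemma cubic_weight_enumerator : exists n1 n2 n3 : nat,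
  [/\ 6 * p%:Z * n1%:Z = p.-1%:Z * (2 * P ^+ 3 - P * (2 * a)),
      6 * p%:Z * n2%:Z = p.-1%:Z * (2 * P ^+ 3 + P * (a + 9 * b)),
      6 * p%:Z * n3%:Z = p.-1%:Z * (2 * P ^+ 3 + P * (a - 9 * b))
    & \sum_(y : K) 'X^(weight y) = 1 + ('X^n1 + 'X^n2 + 'X^n3) *+ c :> {poly int}].
Proof.
have [G [weightG G_class perm_G]] := exists_cubic_power_sums.
have six_p_neq0 : 6 * p%:Z != 0 by rewrite mulf_neq0 // eqz_nat -lt0n prime_gt0.
pose value (s : int) := `|((p.-1%:Z * (2 * P ^+ 3 - s)) %/ (6 * p%:Z))%Z|%N.
have weight6 y : 6 * p%:Z * (weight y)%:Z = p.-1%:Z * (2 * P ^+ 3 - 2 * G y).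
  transitivity (2 * (3 * p%:Z * (weight y)%:Z)); first by ring.
  by rewrite weightG; ring.
have weight_value y : weight y = value (2 * G y) by rewrite /value -weight6 mulKz.
have valueE s : s \in [seq P * v | v <- cubic_triple a b] ->
    6 * p%:Z * (value s)%:Z = p.-1%:Z * (2 * P ^+ 3 - s).
  by rewrite -(perm_mem perm_G) !inE => /or3P[]/eqP->; rewrite -weight_value weight6.
exists (value (P * (2 * a))), (value (P * - (a + 9 * b))), (value (P * - (a - 9 * b))).
split; try by rewrite valueE ?mulrN ?opprK // !inE ?mulrN eqxx ?orbT.
rewrite (sum_power_classes cardK_order g_prim (f := fun y => 'X^(weight y))); last first.
  by move=> y u u_neq0; rewrite !weight_value G_class.
rewrite power_weight0 ?(card_finPcharP cardK) // expr0.
transitivity (1 + (\sum_(s <- [:: 2 * G 1; 2 * G g; 2 * G (g ^+ 2)]) 'X^(value s)) *+ c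
  : {poly int}).
  by rewrite !big_cons big_nil !big_ord_recl big_ord0 !weight_value.
by rewrite (perm_big _ perm_G) /= !big_cons big_nil addr0 addrA.
Qed.

End CubicWeightEnumerator.

(** * Descent to the subfield of order [q] *)

Lemma rmorph_trace_abs (K F : finFieldType) (f : {rmorphism K -> F}) q m (x : K) :
  f (trace_abs q m x) = trace_abs q m (f x).
Proof. by rewrite rmorph_sum; apply: eq_bigr => i _; rewrite rmorphXn. Qed.

Section FrobeniusFixedField.

Variables (F : finFieldType) (q : nat).

(* The phantom argument lets the closure instance below find [pchar_q] by unification. *)
Definition frob_fixed of [pchar F].-nat q : {pred F} := [pred x | x ^+ q == x].

Hypothesis pchar_q : [pchar F].-nat q.

Fact frob_fixed_divring : divring_closed (frob_fixed pchar_q).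
Proof.
split=> [|x y|x y]; rewrite !inE ?expr1n // => /eqP xq /eqP yq.
  by rewrite eq_sym subr_eq -{2}yq -exprDn_pchar // subrK xq.
by rewrite exprMn exprVn xq yq.
Qed.

HB.instance Definition _ :=
  GRing.isDivringClosed.Build F (frob_fixed pchar_q) frob_fixed_divring.

Record frob_field : predArgType :=
  FrobField { frob_val : F; _ : frob_val \in frob_fixed pchar_q }.

HB.instance Definition _ := [isSub for frob_val].
HB.instance Definition _ := [Finite of frob_field by <:].
HB.instance Definition _ := [SubChoice_isSubIntegralDomain of frob_field by <:].
HB.instance Definition _ := [SubIntegralDomain_isSubField of frob_field by <:].

Lemma frob_valX (y : frob_field) : frob_val y ^+ q = frob_val y.
Proof. by apply/eqP; case: y. Qed.

Lemma card_frob_field (g : frob_field) : q.-1.-primitive_root g -> #|frob_field| = q.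
Proof.
move=> g_prim; have q_gt1 : (1 < q)%N by rewrite -subn_gt0 subn1 (prim_order_gt0 g_prim).
have expr_order (y : frob_field) : y != 0 -> y ^+ q.-1 = 1.
  move=> y_neq0; apply: (mulfI y_neq0); rewrite -exprS prednK ?(ltnW q_gt1) // mulr1.
  by apply: val_inj; rewrite rmorphXn /= frob_valX.
have := cardsC1 (0 : frob_field); rewrite (nonzero_prim_root g_prim expr_order).
rewrite card_imset ?card_ord; last exact: prim_root_expr_inj g_prim.
by move=> q_pred; rewrite -(prednK (ltnW q_gt1)) q_pred prednK // ltnW // finNzRing_gt1.
Qed.

End FrobeniusFixedField.

Section KummerCoordinates.

Variables (F : finFieldType) (q r : nat) (beta : F).
Hypotheses (pchar_q : [pchar F].-nat q) (cardF : #|F| = (q ^ r)%N).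
Hypotheses (beta_neq0 : beta != 0) (beta_r_fixed : (beta ^+ r) ^+ q = beta ^+ r).
Hypothesis beta_conj : forall i, (0 < i < r)%N -> beta ^+ (q ^ i) != beta.

Let r_gt0 : (0 < r)%N.
Proof. by have := finNzRing_gt1 F; rewrite cardF; case: (r). Qed.

(* The basis [beta ^+ j], [j < r], has dual basis [beta ^- j / r] for the trace form. *)
Lemma trace_abs_kummer (gamma : F) :
  \sum_(j < r) beta ^- j * trace_abs q r (gamma * beta ^+ j) = gamma *+ r.
Proof.
pose z i := beta ^+ (q ^ i) / beta.
have z_unity i : z i ^+ r = 1.
  by rewrite expr_div_n exprAC (expr_fixed_iter i beta_r_fixed) divff ?expf_neq0.
have z_eq1 (i : 'I_r) : (z i == 1) = (i == Ordinal r_gt0).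
  rewrite -(inj_eq (mulIf beta_neq0)) divfK // mul1r -val_eqE /=.
  case: posnP => [->|i_gt0]; first by rewrite expr1 eqxx.
  by rewrite (negPf (beta_conj _)) // i_gt0 ltn_ord.
transitivity (\sum_(i < r) gamma ^+ (q ^ i) * \sum_(j < r) z i ^+ j).
  under eq_bigr do rewrite mulr_sumr; rewrite exchange_big; apply: eq_bigr => i _ /=.
  rewrite mulr_sumr; apply: eq_bigr => j _.
  by rewrite exprMn expr_div_n -!exprM mulnC [RHS]mulrA mulrC.
under eq_bigr do rewrite sum_expr_unity_root // z_eq1.
rewrite (bigD1 (Ordinal r_gt0)) //= expr1 mulr1 mulr_natr big1 ?addr0 //.
by move=> i /negPf->; rewrite !mulr0.
Qed.

Lemma trace_abs_frob_fixed (gamma : F) : trace_abs q r gamma \in frob_fixed pchar_q.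
Proof. by apply/eqP/trace_abs_fixed; rewrite // -cardF expf_card. Qed.

Definition kummer_coords (gamma : F) : {ffun 'I_r -> frob_field pchar_q} :=
  [ffun j : 'I_r => FrobField (trace_abs_frob_fixed (gamma * beta ^+ j))].

Lemma val_kummer_coords gamma j :
  frob_val (kummer_coords gamma j) = trace_abs q r (gamma * beta ^+ j).
Proof. by rewrite ffunE. Qed.

Lemma kummer_coords_bij :
  r%:R != 0 :> F -> #|frob_field pchar_q| = q -> bijective kummer_coords.
Proof.
move=> r_neq0 cardK; apply: inj_card_bij; last by rewrite card_ffun card_ord cardK cardF.
move=> x y coords_eq; apply: (mulfI r_neq0); rewrite !mulr_natl -!trace_abs_kummer.
by apply: eq_bigr => j _; rewrite -!val_kummer_coords coords_eq.
Qed.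

End KummerCoordinates.

Section Descent.

Variables (F : finFieldType) (p m r d c : nat) (omega : F).
Hypotheses (p_pr : prime p) (r_pr : prime r) (neq_pr : p != r) (co_dr : coprime d r).
Hypotheses (order_q : (p ^ m = (d * c).+1)%N) (q_mod_r : (p ^ m %% r = 1)%N).
Hypothesis cardF : #|F| = ((p ^ m) ^ r)%N.
Hypothesis omega_prim : (#|F|.-1).-primitive_root omega.

Local Notation q := (p ^ m)%N.
Local Notation k := (d * Psi r q %/ r)%N.
Local Notation beta := (omega ^+ k).
Local Notation zeta := (omega ^+ Psi r q).

Let pcharFp : p \in [pchar F].
Proof. by apply: (card_finPcharP (n := (m * r)%N)); rewrite // cardF expnM. Qed.

Let pchar_q : [pchar F].-nat q.
Proof. by rewrite pnatX pnatE ?pcharFp. Qed.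

Let pred_exp_Psi i : ((q ^ i).-1 = d * c * Psi i q)%N.
Proof. by rewrite predn_exp /Psi order_q. Qed.

Let dvdn_r_Psi i : (r %| Psi i q)%N = (r %| i)%N.
Proof. by rewrite /dvdn Psi_mod. Qed.

Let k_r : (k * r = d * Psi r q)%N.
Proof. by rewrite divnK // dvdn_mull // dvdn_r_Psi. Qed.

Let order_F : (#|F|.-1 = k * (r * c))%N.
Proof. by rewrite cardF pred_exp_Psi mulnA k_r mulnAC. Qed.

Let order_gt0 : (0 < k * (r * c))%N.
Proof. by rewrite -order_F (prim_order_gt0 omega_prim). Qed.

Let k_gt0 : (0 < k)%N.
Proof. by move: order_gt0; rewrite muln_gt0 => /andP[]. Qed.

Let order_q_gt0 : (0 < d * c)%N.
Proof.
by have := prim_order_gt0 omega_prim; rewrite cardF pred_exp_Psi muln_gt0 => /andP[].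
Qed.

Let c_gt0 : (0 < c)%N.
Proof. by move: order_q_gt0; rewrite muln_gt0 => /andP[]. Qed.

Let zeta_prim : (d * c).-primitive_root zeta.
Proof.
have dvd : (d * c %| #|F|.-1)%N by rewrite cardF pred_exp_Psi dvdn_mulr.
by have := dvdn_prim_root omega_prim dvd; rewrite cardF pred_exp_Psi mulKn.
Qed.

Let zeta_fixed : zeta ^+ q = zeta.
Proof. by have := mulr1 zeta; rewrite -{1}(prim_expr_order zeta_prim) -exprS -order_q. Qed.

Let beta_neq0 : beta != 0.
Proof. by rewrite expf_neq0 // (prim_root_neq0 omega_prim). Qed.

Let beta_r : beta ^+ r = zeta ^+ d.
Proof. by rewrite -!exprM k_r mulnC. Qed.

Let beta_r_fixed : (beta ^+ r) ^+ q = beta ^+ r.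
Proof. by rewrite beta_r exprAC zeta_fixed. Qed.

Let beta_conj i : (0 < i < r)%N -> beta ^+ (q ^ i) != beta.
Proof.
case/andP=> i_gt0 lt_ir; rewrite -exprM (eq_prim_root_expr omega_prim) order_F.
rewrite eqn_mod_dvd ?leq_pmulr ?expn_gt0 ?prime_gt0 //.
rewrite -{3}[k]muln1 -mulnBr dvdn_pmul2l // subn1 pred_exp_Psi mulnAC dvdn_pmul2r //.
by rewrite Gauss_dvdr ?dvdn_r_Psi ?gtnNdvd // coprime_sym.
Qed.

Let g : frob_field pchar_q := FrobField (introT eqP zeta_fixed).

Let incl : {rmorphism frob_field pchar_q -> F} := val.

Let g_prim : (d * c).-primitive_root g.
Proof. by rewrite -(fmorph_primitive_root incl). Qed.

Local Notation coords := (kummer_coords beta pchar_q cardF).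

(* [omega ^+ (k * (r * s + j)) = beta ^+ j * zeta ^+ (d * s)] since [k * r = d * Psi r q]. *)
Lemma cw_weight_kummer (gamma : F) :
  cw_weight p (m * r) k omega gamma = (\sum_j power_weight p m d c g (coords gamma j))%N.
Proof.
rewrite /cw_weight (card_set_sum (fun i : 'I_(_) =>
  trace_abs p (m * r) (gamma * omega ^+ (k * i)) != 0)) order_F mulKn //.
rewrite (big_ord_mul _ r c (fun i =>
  (trace_abs p (m * r) (gamma * omega ^+ (k * i)) != 0) : nat)) exchange_big /=.
apply: eq_bigr => j _; rewrite /power_weight card_set_sum; apply: eq_bigr => s _.
congr (nat_of_bool (~~ _)); rewrite -(inj_eq val_inj) raddf0.
rewrite (rmorph_trace_abs incl) rmorphM rmorphXn /=.
rewrite val_kummer_coords -trace_absMr //; last by rewrite exprAC zeta_fixed.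
rewrite trace_abs_tower ?pnatE //; congr (trace_abs p m (trace_abs q r _) == 0).
rewrite -mulrA; congr (_ * _); rewrite mulnDr exprD [RHS]mulrC -!exprM.
by rewrite mulnA k_r [in RHS]mulnA (mulnC (Psi r q)).
Qed.

Lemma weight_enumerator_descent :
  exists (K : finFieldType) (g : K),
  [/\ #|K| = q, (d * c).-primitive_root g
    & \sum_(gamma : F) 'X^(cw_weight p (m * r) k omega gamma) =
      (\sum_(y : K) 'X^(power_weight p m d c g y)) ^+ r :> {poly int}].
Proof.
have q_pred : q.-1 = (d * c)%N by rewrite order_q.
have cardK : #|frob_field pchar_q| = q.
  by apply: (@card_frob_field _ _ _ g); rewrite q_pred.
have r_neq0 : r%:R != 0 :> F by rewrite -(dvdn_pcharf pcharFp) dvdn_prime2.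
have coords_bij := kummer_coords_bij cardF beta_neq0 beta_r_fixed beta_conj r_neq0 cardK.
exists (frob_field pchar_q), g; split=> //.
under eq_bigr do rewrite cw_weight_kummer.
rewrite -[r in RHS]card_ord -prodr_const bigA_distr_bigA.
rewrite (reindex coords) /=; last exact: onW_bij.
by apply: eq_bigr => gamma _; apply: (big_morph _ (exprD 'X) (expr0 'X)).
Qed.

End Descent.

(** * Expansion of the weight enumerator *)

Lemma trinomial_fact n i j k : (i + j + k <= n ->
  'C(n, i) * 'C(n - i, j) * 'C(n - i - j, k) * (i`! * j`! * k`! * (n - (i + j + k))`!)
    = n`!)%N.
Proof.
move=> le_n; have le_i : (i <= n)%N by lia.
have le_j : (j <= n - i)%N by lia.
have le_k : (k <= n - i - j)%N by lia.
rewrite -(bin_fact le_i) -(bin_fact le_j) -(bin_fact le_k) -!subnDA.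
move: 'C(_, _) 'C(_, _) 'C(_, _) i`! j`! k`! (n - (i + j + k))`!; clear; lia.
Qed.

Lemma multinom3_fact i j k : (multinom3 i j k * (i`! * j`! * k`!) = (i + j + k)`!)%N.
Proof.
rewrite divnK // -(trinomial_fact (leqnn (i + j + k))) subnn fact0 muln1.
exact: dvdn_mull.
Qed.

Lemma bin_multinom3 n i j k :
  ('C(n, i) * 'C(n - i, j) * 'C(n - i - j, k) =
    if i + j + k <= n then 'C(n, i + j + k) * multinom3 i j k else 0)%N.
Proof.
case: leqP => [le_n|lt_n].
  have fact_pos : (0 < i`! * j`! * k`! * (n - (i + j + k))`!)%N.
    by rewrite !muln_gt0 !fact_gt0.
  apply/eqP; rewrite -(eqn_pmul2r fact_pos) trinomial_fact // -(bin_fact le_n).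
  by rewrite -multinom3_fact !mulnA.
have [lt_i|le_i] := ltnP n i; first by rewrite bin_small.
have [lt_j|le_j] := ltnP (n - i) j; first by rewrite (bin_small lt_j) muln0.
by rewrite (@bin_small (n - i - j)) ?muln0 //; lia.
Qed.

Lemma exprDn_widen (R : comNzRingType) (x y : R) n N : (n <= N)%N ->
  (x + y) ^+ n = \sum_(i < N.+1) (x ^+ (n - i) * y ^+ i) *+ 'C(n, i).
Proof.
move=> le_n; rewrite exprDn.
rewrite (big_ord_widen N.+1 (fun i => x ^+ (n - i) * y ^+ i *+ 'C(n, i))) // big_mkcond.
apply: eq_bigr => i _; case: ltnP => // lt_n.
by rewrite bin_small ?mulr0n.
Qed.

Lemma expr1D3n (R : comNzRingType) (x y z : R) n :
  (1 + (x + y + z)) ^+ n =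
    \sum_(i < n.+1) \sum_(j < n.+1) \sum_(k < n.+1 | (i + j + k <= n)%N)
      (x ^+ i * y ^+ j * z ^+ k) *+ ('C(n, i + j + k) * multinom3 i j k).
Proof.
have -> : 1 + (x + y + z) = 1 + z + y + x by ring.
rewrite (exprDn_widen _ _ (leqnn n)); apply: eq_bigr => i _.
rewrite (@exprDn_widen _ _ _ (n - i) n) ?leq_subr // mulr_suml -sumrMnl.
apply: eq_bigr => j _.
rewrite (@exprDn_widen _ _ _ (n - i - j) n); last by rewrite -subnDA leq_subr.
rewrite mulr_suml -sumrMnl mulr_suml -sumrMnl [RHS]big_mkcond; apply: eq_bigr => k _ /=.
transitivity ((x ^+ i * y ^+ j * z ^+ k) *+
    ('C(n, i) * 'C(n - i, j) * 'C(n - i - j, k))).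
  rewrite expr1n mul1r !mulrnAl -!mulrnA -mulrA mulrC (mulrC (y ^+ j)).
  by congr (_ *+ _); move: 'C(_, _) 'C(_, _) 'C(_, _); clear; lia.
by rewrite bin_multinom3; case: ifP.
Qed.

Lemma coef_expr1D3n (c n n1 n2 n3 w : nat) :
  ((1 + ('X^n1 + 'X^n2 + 'X^n3) *+ c) ^+ n : {poly int})`_w =
    Posz (\sum_(i < n.+1) \sum_(j < n.+1) \sum_(k < n.+1
        | (i + j + k <= n)%N && (w == n1 * i + n2 * j + n3 * k)%N)
      'C(n, i + j + k) * multinom3 i j k * c ^ (i + j + k))%N.
Proof.
rewrite !mulrnDl expr1D3n coef_sum -[RHS]natz natr_sum; apply: eq_bigr => i _.
rewrite coef_sum natr_sum; apply: eq_bigr => j _.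
rewrite coef_sum natr_sum big_mkcondr; apply: eq_bigr => k _.
rewrite !exprMn_n !(mulrnAl, mulrnAr) -!mulrnA -!exprM -!exprD.
rewrite coefMn coefXn !expnD; case: eqP => _; last by rewrite mul0rn.
congr (1 *+ _).
by move: 'C(_, _) (multinom3 _ _ _) (c ^ i)%N (c ^ j)%N (c ^ k)%N; clear; lia.
Qed.

Lemma coef_sum_Xn (T : finType) (f : T -> nat) w :
  (\sum_x 'X^(f x) : {poly int})`_w = #|[set x | f x == w]|%:Z.
Proof.
rewrite coef_sum card_set_sum -[RHS]natz natr_sum.
by apply: eq_bigr => x _; rewrite coefXn eq_sym.
Qed.

Lemma val_ordD_small n (i j : 'I_n.+1) : (i + j <= n)%N -> (i + j)%R = (i + j)%N :> nat.
Proof. by move=> le_n; rewrite /= modn_small. Qed.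

Lemma cubic_weight_formula (p n1 n2 n3 l1 l2 l3 : nat) (P Q a b : int) : (0 < p)%N ->
  6 * p%:Z * n1%:Z = p.-1%:Z * (2 * Q - P * (2 * a)) ->
  6 * p%:Z * n2%:Z = p.-1%:Z * (2 * Q + P * (a + 9 * b)) ->
  6 * p%:Z * n3%:Z = p.-1%:Z * (2 * Q + P * (a - 9 * b)) ->
  (p%:Q - 1) / (3 * p%:Q) *
    ((l1 + l2 + l3)%N%:Q * Q%:Q +
     (a%:~R * ((l2 + l3)%N%:Q / 2 - l1%:Q) + 9 * b%:~R / 2 * (l2%:Q - l3%:Q)) * P%:Q)
  = (n1 * l1 + n2 * l2 + n3 * l3)%N%:Q.
Proof.
move=> p_gt0 /(congr1 (intr : int -> rat)) n1E /(congr1 (intr : int -> rat)) n2E.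
move=> /(congr1 (intr : int -> rat)) n3E.
have p_neq0 : p%:Q != 0 by rewrite intr_eq0 eqz_nat -lt0n.
have p_predE : p.-1%:Q = p%:Q - 1.
  by rewrite -[in RHS](prednK p_gt0) -addn1 PoszD rmorphD addrK.
move: n1E n2E n3E; rewrite !PoszD !PoszM !(rmorphM, rmorphD, rmorphB, rmorphN) /= p_predE.
move=> n1E n2E n3E; apply: (mulfI (_ : 6 * p%:Q != 0)); first by rewrite mulf_neq0.
rewrite !mulrDr !mulrA n1E n2E n3E; field; exact: p_neq0.
Qed.

Theorem theorem5p1 (p r t : nat) (a b : int)
  (F : finFieldType) (omega : F) :
  prime p -> prime r -> p != r ->
  (p %% 3 = 1)%N -> coprime 3 r -> (1 <= t)%N ->
  let m := (3 * t)%N in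
  let q := (p ^ m)%N in
  let c := ((q - 1) %/ 3)%N in
  let k := ((3 * Psi r q) %/ r)%N in
  (q %% r = 1)%N ->
  4 * (p%:Z) ^+ t = a ^+ 2 + 27 * b ^+ 2 ->
  (a %% 3)%Z = 1 ->
  coprimez a p ->
  #|F| = (q ^ r)%N ->
  (#|F|.-1).-primitive_root omega ->
  forall w : nat,
    cw_freq p (m * r) k omega w =
    (\sum_(l1 < r.+1) \sum_(l2 < r.+1) \sum_(l3 < r.+1
       | (l1 + l2 + l3 <= r)%N &&
         ((w%:Q : rat) ==
             ((p%:Q - 1) / (3 * p%:Q)) *
             ((l1 + l2 + l3)%:Q * q%:Q +
              ((a%:~R : rat) * (((l2 + l3)%:Q) / 2 - l1%:Q) +
               9 * (b%:~R : rat) / 2 * (l2%:Q - l3%:Q)) * (p%:Q) ^+ t))%R)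
       'C(r, l1 + l2 + l3) * multinom3 l1 l2 l3 * c ^ (l1 + l2 + l3))%N.
Proof.
move=> p_pr r_pr neq_pr p_mod3 co3r t_gt0 m q c k q_mod_r reprP a_mod3 co_ap.
move=> cardF om_prim w.
have order_q : (p ^ m = (3 * c).+1)%N.
  by have := modn_exp1 m p_mod3; rewrite /c /q; move: (p ^ m)%N; clear; lia.
have pNa : ~~ (p %| a)%Z by rewrite dvdzE -prime_coprime // -coprimezE coprimez_sym.
have [K [g [cardK g_prim descent]]] :=
  weight_enumerator_descent p_pr r_pr neq_pr co3r order_q q_mod_r cardF om_prim.
have [n1 [n2 [n3 [n1E n2E n3E enumerator]]]] :=
  cubic_weight_enumerator p_pr p_mod3 t_gt0 cardK order_q g_prim reprP a_mod3 pNa.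
apply/eqP; rewrite -eqz_nat -coef_sum_Xn descent enumerator coef_expr1D3n eqz_nat.
apply/eqP; apply: eq_bigr => l1 _; apply: eq_bigr => l2 _; apply: eq_bigl => l3.
case: leqP => // le_h; rewrite !andTb.
have le_12 : (l1 + l2 <= r)%N by apply: leq_trans le_h; apply: leq_addr.
have le_23 : (l2 + l3 <= r)%N by apply: leq_trans le_h; rewrite -addnA leq_addl.
(* In the statement these sums are taken in ['I_r.+1], that is, modulo [r.+1]. *)
have -> : (l1 + l2 + l3)%R = (l1 + l2 + l3)%N :> nat by rewrite !val_ordD_small.
rewrite (val_ordD_small le_23) Posz_expnM -[p%:Q ^+ t]rmorphXn.
by rewrite (cubic_weight_formula _ _ _ (prime_gt0 p_pr) n1E n2E n3E) eqr_int eqz_nat.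
Qed.
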